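(* Let $X\subseteq\{0,1\}^n$ and $f:X\to\{0,1\}$. Given an $f$-deciding vector set with maximum rank $\kappa'$ and size $A$, there exists an $f$-deciding vector set with dimension $\kappa'$ and size at most $A$; consequently there is a bounded-error quantum query algorithm deciding $f$ with query complexity $O(A)$ and space complexity $O(\log(n\kappa'))$ qubits.
   Context: An $f$-deciding vector set is a family $\{\ket{v_{x,j}}\in\mathbb{C}^m\}_{x\in X,j\in[n]}$ such that for all $x,y\in X$ with $f(x)\ne f(y)$, $\sum_{j:x_j\ne y_j}\braket{v_{x,j}}{v_{y,j}}=1$. Its size is $\max_{x\in X}\sum_j\|\ket{v_{x,j}}\|^2$, its dimension is $m$, and its maximum rank is $\max_{j\in[n]}\dim\operatorname{span}\{\ket{v_{x,j}}:f(x)=1\}$. A bounded-error quantum query algorithm for $f$ has the form $U_TO_xU_{T-1}O_x\cdots U_1O_xU_0\ket{\hat 0}$ followed by a two-outcome measurement, where the unitaries $U_0,\dots,U_T$ (independent of $x$) act on a Hilbert space of dimension $S$, $O_x\ket{i}\ket{b}=\ket{i}\ket{b\oplus x_i}$, and for every $x\in X$ the output equals $f(x)$ with probability at least $2/3$; its query complexity is $T$ and its space complexity is $\log S$ qubits. *)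

(* Defs.v *)
From HB Require Import structures.
From mathcomp Require Import all_boot all_order all_algebra.
From mathcomp Require Import complex reals.
Set Implicit Arguments. Unset Strict Implicit. Unset Printing Implicit Defensive.
Import Order.TTheory GRing.Theory Num.Theory.
Local Open Scope ring_scope.

Definition cube (n : nat) := {ffun 'I_n -> bool}.

Section Defs.
Variable R : realType.
Local Notation C := R[i].

Definition sqnorm (z : C) : R := complex.Re z ^+ 2 + complex.Im z ^+ 2.

Definition dotc (m : nat) (u v : 'I_m -> C) : C :=
  \sum_(k < m) conjc (u k) * v k.

Definition vnorm2 (m : nat) (u : 'I_m -> C) : R := \sum_(k < m) sqnorm (u k).

Variables (n : nat) (X : {set cube n}) (f : cube n -> bool).

(* A family {|v_{x,j}> in C^m}_{x in X, j in [n]} (values outside X are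
   irrelevant) is f-deciding. Its dimension is m. *)
Definition deciding (m : nat) (v : cube n -> 'I_n -> 'I_m -> C) : Prop :=
  forall x y, x \in X -> y \in X -> f x != f y ->
    \sum_(j < n | x j != y j) dotc (v x j) (v y j) = 1.

Definition vsize (m : nat) (v : cube n -> 'I_n -> 'I_m -> C) : R :=
  \big[Num.max/0]_(x in X) \sum_(j < n) vnorm2 (v x j).

(* dim span{ |v_{x,j}> : x in X, f(x) = 1 }, computed as the rank of the
   matrix whose rows are these vectors (other rows set to 0). *)
Definition rank_at (m : nat) (v : cube n -> 'I_n -> 'I_m -> C) (j : 'I_n) : nat :=
  \rank (\matrix_(i < #|{: cube n}|, k < m)
           (let x := enum_val i in if (x \in X) && f x then v x j k else 0)).

Definition maxrank (m : nat) (v : cube n -> 'I_n -> 'I_m -> C) : nat :=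
  \max_(j < n) rank_at v j.

(* Hilbert space with basis |i>|b>|w>, i in [n], b in {0,1}, w in [W];
   its dimension is S = n * 2 * W. *)
Definition qspace (W : nat) := ('I_n * bool * 'I_W)%type.

Variable W : nat.
Local Notation Q := (qspace W).

Definition qapply (M : Q -> Q -> C) (psi : Q -> C) : Q -> C :=
  fun a => \sum_(b : Q) M a b * psi b.

Definition unitary (M : Q -> Q -> C) : Prop :=
  forall a b, \sum_(q : Q) conjc (M q a) * M q b = (a == b)%:R.

(* orthogonal projector (defines the two-outcome measurement {P, 1 - P}) *)
Definition projector (P : Q -> Q -> C) : Prop :=
  (forall a b, P a b = conjc (P b a)) /\
  (forall a b, \sum_(q : Q) P a q * P q b = P a b).

(* O_x |i>|b>|w> = |i>|b xor x_i>|w> *)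
Definition oracle (x : cube n) (psi : Q -> C) : Q -> C :=
  fun q => let: (i, b, w) := q in psi (i, b (+) x i, w).

Definition basis (q0 : Q) : Q -> C := fun q => (q == q0)%:R.

Fixpoint qstate (x : cube n) (U : nat -> Q -> Q -> C) (q0 : Q) (t : nat)
  : Q -> C :=
  match t with
  | 0 => qapply (U 0%N) (basis q0)
  | t'.+1 => qapply (U t) (oracle x (qstate x U q0 t'))
  end.

Definition prob1 (P : Q -> Q -> C) (psi : Q -> C) : R :=
  \sum_(q : Q) sqnorm (qapply P psi q).
Definition prob0 (P : Q -> Q -> C) (psi : Q -> C) : R :=
  \sum_(q : Q) sqnorm (psi q - qapply P psi q).

Definition decides_f (T : nat) (U : nat -> Q -> Q -> C) (q0 : Q)
  (P : Q -> Q -> C) : Prop :=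
  (forall t, (t <= T)%N -> unitary (U t)) /\ projector P /\
  (forall x, x \in X ->
     if f x then 2%:R / 3%:R <= prob1 P (qstate x U q0 T)
     else 2%:R / 3%:R <= prob0 P (qstate x U q0 T)).

End Defs.

(* Main.v *)
Require Import Defs.
From HB Require Import structures.
From mathcomp Require Import all_boot all_order all_algebra.
From mathcomp Require Import complex reals spectral.
From mathcomp Require Import ring lra zify.
Import Order.TTheory GRing.Theory Num.Theory.
Local Open Scope ring_scope.

(* Dimension: two inputs with different values always include one with value 1,
   so inner products only see the projection of [v x j] onto the span of the
   vectors of 1-inputs; write this projection in an orthonormal basis.

   Algorithm: encode the deciding vectors of [x] as a single vector [psi x] whose
   inner product with [psi y] is [-1] whenever [f x <> f y].  Reflecting about
   the span of the [eP + psi y] with [f y = 0] and then querying once maps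
   [eP + psi x] to [+- eP + psi x], the sign being [f x], so [psi x] is returned
   unchanged.  Feed a state to [eP] in [K] portions of amplitude [1 / sqrt (2K)]:
   all portions share the one catalyst [psi x / sqrt (2K)], whose omission from
   the initial state costs an error of norm at most [sqrt (A / (2K))].  Taking
   [K] about [50 A] gives bounded error.  The portions are cut and merged by
   time-dependent reflections, not by a clock register, so the space does not
   depend on [A]. *)

(** * Hermitian forms, isometries, reflections and orthogonal projectors *)

Section HermitianSpace.
Set Implicit Arguments.
Unset Strict Implicit.
Variables (R : realType) (V : lmodType R[i]) (inner : V -> V -> R[i]).
Local Notation C := R[i].
Implicit Types (u v w z : V) (a b : C) (F P : V -> V).

Lemma conjcM a b : conjc (a * b) = conjc a * conjc b.
Proof. exact: rmorphM. Qed.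

Lemma mulJ_sqnorm a : conjc a * a = (sqnorm a)%:C%C.
Proof. by case: a => x y; rewrite /sqnorm; simpc => /=; congr Complex; ring. Qed.

Lemma sqnorm_ge0 a : 0 <= sqnorm a.
Proof. by rewrite addr_ge0 ?sqr_ge0. Qed.

Definition hermitian_form :=
  [/\ forall u v w, inner u (v + w) = inner u v + inner u w,
      forall a u v, inner u (a *: v) = a * inner u v,
      forall u v, conjc (inner u v) = inner v u,
      forall u, 0 <= inner u u &
      forall u, inner u u = 0 -> u = 0].

Definition sqn u : R := complex.Re (inner u u).

Definition lin_isometry F :=
  linear F /\ forall u v, inner (F u) (F v) = inner u v.

Definition orthoproj P :=
  [/\ linear P, forall u v, inner (P u) v = inner u (P v) & forall u, P (P u) = P u].

Section LinearMaps.
Variable F : V -> V.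
Hypothesis linF : linear F.

Lemma linD u v : F (u + v) = F u + F v.
Proof. by have := linF 1 u v; rewrite !scale1r. Qed.

Lemma lin0 : F 0 = 0.
Proof. by apply: (addrI (F 0)); rewrite -linD !addr0. Qed.

Lemma linZ a u : F (a *: u) = a *: F u.
Proof. by have := linF a u 0; rewrite lin0 !addr0. Qed.

Lemma linN u : F (- u) = - F u.
Proof. by rewrite -scaleN1r linZ scaleN1r. Qed.

Lemma lin_sum (I : finType) (G : I -> V) : F (\sum_i G i) = \sum_i F (G i).
Proof. exact: (big_morph F linD lin0). Qed.

End LinearMaps.

Definition linE F (linF : linear F) := (linD linF, linN linF, linZ linF).

Hypothesis inner_herm : hermitian_form.

Let innerDr u v w : inner u (v + w) = inner u v + inner u w.
Proof. by case: inner_herm. Qed.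

Let innerZr a u v : inner u (a *: v) = a * inner u v.
Proof. by case: inner_herm. Qed.

Lemma conj_inner u v : conjc (inner u v) = inner v u.
Proof. by case: inner_herm. Qed.

Lemma inner_eq0 u : inner u u = 0 -> u = 0.
Proof. by case: inner_herm => _ _ _ _; apply. Qed.

Lemma innerDl u v w : inner (u + v) w = inner u w + inner v w.
Proof. by rewrite -conj_inner innerDr rmorphD /= !conj_inner. Qed.

Lemma innerZl a u v : inner (a *: u) v = conjc a * inner u v.
Proof. by rewrite -conj_inner innerZr conjcM conj_inner. Qed.

Lemma innerNr u v : inner u (- v) = - inner u v.
Proof. by rewrite -scaleN1r innerZr mulN1r. Qed.

Lemma innerNl u v : inner (- u) v = - inner u v.
Proof. by rewrite -conj_inner innerNr rmorphN /= conj_inner. Qed.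

Lemma inner0r u : inner u 0 = 0.
Proof. by rewrite -(scale0r 0) innerZr mul0r. Qed.

Lemma inner0l u : inner 0 u = 0.
Proof. by rewrite -conj_inner inner0r conjc0. Qed.

Definition innerE := (innerDl, innerDr, innerNl, innerNr, innerZl, innerZr).

Lemma inner_eq0C u v : inner u v = 0 -> inner v u = 0.
Proof. by move=> uv0; rewrite -conj_inner uv0 conjc0. Qed.

Lemma inner_sqn u : inner u u = (sqn u)%:C%C.
Proof.
have /ger0_Im : 0 <= inner u u by case: inner_herm.
by rewrite /sqn; case: (inner u u) => x y /= ->.
Qed.

Lemma sqn_ge0 u : 0 <= sqn u.
Proof. by rewrite -ler0c -inner_sqn; case: inner_herm. Qed.

Lemma sqnZ a u : sqn (a *: u) = sqnorm a * sqn u.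
Proof.
apply: complexI; rewrite rmorphM /= -!inner_sqn -mulJ_sqnorm innerZl innerZr.
by rewrite mulrA.
Qed.

(* From [0 <= |u + 10 v|^2 / 10]. *)
Lemma sqnD_ge u v : 9%:R / 10%:R * sqn u - 9%:R * sqn v <= sqn (u + v).
Proof.
have := sqn_ge0 (u + 10%:R *: v); rewrite /sqn !innerE conjc_nat.
rewrite !inner_sqn -(conj_inner u v); case: (inner u v) => x y.
by rewrite -!(rmorph_nat (real_complex R)) /=; simpc => /=; nra.
Qed.

(** Expand [0 <= |u + v|^2]. This later bounds the size of a deciding vector set below by 1. *)
Lemma sqn_anticorrelated u v : inner u v = -1 -> 2%:R <= sqn u + sqn v.
Proof.
move=> uv; have vu : inner v u = -1 by rewrite -conj_inner uv rmorphN1.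
have uvE : sqn (u + v) = sqn u + sqn v - 2%:R.
  by apply: complexI; rewrite rmorphB rmorphD rmorph_nat /= -!inner_sqn !innerE uv vu;
     ring.
by have := sqn_ge0 (u + v); rewrite uvE subr_ge0.
Qed.

Lemma lin_isometry_sqn F u : lin_isometry F -> sqn (F u) = sqn u.
Proof. by rewrite /sqn => -[_ ->]. Qed.

Lemma lin_isometry_comp F G : lin_isometry F -> lin_isometry G -> lin_isometry (F \o G).
Proof.
move=> [linF isoF] [linG isoG]; split=> [a u v|u v] /=; last by rewrite isoF.
by rewrite linG linF.
Qed.

(* For [w = 0] this is the identity, since then [_ / 0 = 0]. *)
Definition householder w u := u - (2%:R * inner w u / inner w w) *: w.

Lemma householder_isometry w : lin_isometry (householder w).
Proof.
split=> [a u v|u v].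
  rewrite /householder !innerE scalerBr -!addrA; congr (_ + _).
  rewrite addrCA; congr (_ + _); rewrite -opprD; congr (- _).
  by rewrite scalerA -scalerDl; congr (_ *: _); ring.
rewrite /householder !innerE !conjcM conjc_inv conjc_nat !conj_inner.
have [->|w0] := eqVneq (inner w w) 0; first by rewrite invr0; ring.
by field.
Qed.

Lemma householder_fix w u : inner w u = 0 -> householder w u = u.
Proof. by move=> wu; rewrite /householder wu mulr0 mul0r scale0r subr0. Qed.

(** Equal norms and a real product make [2 <u - v, u>] equal to [|u - v|^2], so exactly [u - v] is
    subtracted from [u]. Over the complex numbers equal norms alone would not suffice. *)
Lemma householder_swap u v :
  inner u u = inner v v -> inner u v = inner v u -> householder (u - v) u = v.
Proof.
move=> uu_vv uv_vu; have [/inner_eq0 uv0|uv0] := eqVneq (inner (u - v) (u - v)) 0.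
  by rewrite householder_fix ?uv0 ?inner0l // (subr0_eq uv0).
rewrite /householder -[2%:R * _](_ : inner (u - v) (u - v) = _).
  by rewrite divff // scale1r opprB addrC subrK.
by rewrite !innerE uv_vu -uu_vv; ring.
Qed.

Lemma householderN w : householder (- w) =1 householder w.
Proof.
move=> u; rewrite /householder !(innerNl, innerNr) opprK mulrN mulNr.
by rewrite scaleNr scalerN opprK.
Qed.

(** Gram-Schmidt: each new [u] adds the rank-one projector onto [w = u - P u], which vanishes when
    [w = 0]. The last clause keeps the range of [P] within the span of [s]. *)
Lemma orthoproj_exists (s : seq V) :
  exists P, [/\ orthoproj P, forall u, u \in s -> P u = u &
    forall z, (forall u, u \in s -> inner u z = 0) -> P z = 0].
Proof.
elim: s => [|u s [P [[linP adjP idP] fixP killP]]].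
  exists (fun=> 0); split=> //; split=> // [a u v|u v].
    by rewrite scaler0 addr0.
  by rewrite inner0l inner0r.
have [w wE] : exists w, w = u - P u by exists (u - P u).
have Pw : P w = 0 by rewrite wE !(linE linP) idP subrr.
have w_P z : inner w (P z) = 0 by rewrite -adjP Pw inner0l.
have wK : (inner w w / inner w w) *: w = w.
  have [/inner_eq0 ->|w0] := eqVneq (inner w w) 0; first by rewrite scaler0.
  by rewrite divff ?scale1r.
exists (fun z => P z + (inner w z / inner w w) *: w); split.
- split=> [a x y|x y|x].
  + rewrite (linP a) !innerE scalerDr -!addrA; congr (_ + _).
    by rewrite addrCA; congr (_ + _); rewrite scalerA -scalerDl; congr (_ *: _); ring.
  + rewrite !innerE adjP conjcM conjc_inv !conj_inner; congr (_ + _); ring.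
  + rewrite !(linE linP) Pw scaler0 addr0 idP; congr (_ + _).
    by rewrite innerDr w_P add0r innerZr -mulrA -scalerA wK.
- move=> x; rewrite inE => /predU1P[->|xs].
    have -> : inner w u = inner w w by rewrite {3}wE innerDr innerNr w_P subr0.
    by rewrite wK wE addrC subrK.
  by rewrite -{2}(fixP x xs) w_P mul0r scale0r addr0 fixP.
- move=> z z_us; have Pz : P z = 0.
    by apply: killP => x xs; rewrite z_us // inE xs orbT.
  rewrite Pz add0r {1}wE innerDl innerNl z_us ?mem_head // adjP Pz.
  by rewrite inner0r subr0 mul0r scale0r.
Qed.

Section Projections.
Variable P : V -> V.
Hypothesis orthoP : orthoproj P.

Lemma orthoproj_reflection : lin_isometry (fun u => u - 2%:R *: P u).
Proof.
case: orthoP => linP adjP idP; split=> [a u v|u v].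
  rewrite (linP a) !scalerDr -!addrA; congr (_ + _).
  rewrite opprD addrCA; congr (_ + (_ - _)).
  by rewrite scalerN !scalerA mulrC.
by rewrite !innerE conjc_nat -!adjP idP; ring.
Qed.

Lemma sqn_orthoproj u : sqn u = sqn (P u) + sqn (u - P u).
Proof.
case: orthoP => linP adjP idP; apply: complexI.
by rewrite rmorphD /= -!inner_sqn !innerE -!adjP !idP; ring.
Qed.

End Projections.

(** * Catalytic computation by isometries and queries *)

Fixpoint evolve (I : Type) (orc : I -> V -> V) (pre post : nat -> V -> V) x u0 t : V :=
  if t is t'.+1 then post t' (orc x (pre t' (evolve orc pre post x u0 t'))) else u0.

(* One query, between two fixed isometries, sends [eP + psi x] to
   [s x *: eP + psi x]: the vector [psi x] is a catalyst.  [eA] is the reservoir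
   of amplitude still to be processed, [eB] collects the processed amplitude,
   multiplied by [s x], and [eD] is an untouched reference against which the
   sign is finally measured. *)
Section Catalyst.
Variables (I : finType) (X : {set I}) (f : I -> bool) (A : R) (K : nat).
Variables (E : bool * bool -> V) (psi : I -> V) (orc : I -> V -> V) (Z : V -> V) (k0 : V).
Let s x : C := (-1) ^+ ~~ f x.
Hypotheses (k0_unit : inner k0 k0 = 1).
Hypotheses (k0_E : forall i, inner k0 (E i) = inner (E i) k0).
Hypotheses (orc_isometry : forall x, lin_isometry (orc x)).
Hypotheses (E_orth : forall i j, inner (E i) (E j) = (i == j)%:R).
Hypotheses (E_psi : forall i x, inner (E i) (psi x) = 0).
Hypotheses (psi_le : forall x, x \in X -> sqn (psi x) <= A).
Hypotheses (psi_decides : forall x y, x \in X -> y \in X -> f x != f y ->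
  inner (psi x) (psi y) = -1).
Hypotheses (Z_iso : lin_isometry Z).
Hypotheses (Z_E : forall x i, Z (orc x (E i)) = E i).
Hypotheses (Z_psi : forall x, Z (orc x (psi x)) = s x *: psi x).
Hypotheses (K_gt0 : (0 < K)%N) (K_ge : 50%:R * A <= K%:R).

Let eA := E (false, false).
Let eB := E (false, true).
Let eD := E (true, false).
Let eP := E (true, true).

(** If [f x] is true, [eP + psi x] is orthogonal to each [eP + psi y] with [f y] false, since
    [1 + (-1) = 0], and is fixed. Otherwise it is one of the spanning vectors and is negated; the
    query followed by [Z] then restores the sign of [psi x] only. *)
Lemma query_reflection : exists Rf, [/\ lin_isometry Rf,
  forall x i, i != (true, true) -> Z (orc x (Rf (E i))) = E i &
  forall x, x \in X -> Z (orc x (Rf (eP + psi x))) = s x *: eP + psi x].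
Proof.
have [P [orthoP fixP killP]] :=
  orthoproj_exists [seq eP + psi y | y <- enum X & ~~ f y].
have [linZ _] := Z_iso.
exists (fun u => u - 2%:R *: P u); split=> [|x i iP|x xX].
- exact: orthoproj_reflection.
- rewrite killP ?scaler0 ?subr0 // => u /mapP[y _ ->].
  by rewrite innerDl E_orth (inner_eq0C (E_psi _ _)) addr0 eq_sym (negbTE iP).
have [linO _] := orc_isometry x.
rewrite /s; case fx: (f x).
  rewrite killP ?scaler0 ?subr0; last first.
    move=> u /mapP[y]; rewrite mem_filter mem_enum => /andP[fy yX] ->.
    rewrite !innerE E_orth E_psi (inner_eq0C (E_psi _ _)) psi_decides ?fx ?(negbTE fy) //.
    by rewrite eqxx addr0 add0r subrr.
  by rewrite (linD linO) (linD linZ) Z_E Z_psi /s fx !scale1r.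
rewrite fixP; last by apply/map_f; rewrite mem_filter mem_enum fx xX.
have -> : eP + psi x - 2%:R *: (eP + psi x) = - (eP + psi x).
  by rewrite scaler_nat mulr2n opprD addNKr.
rewrite (linN linO) (linN linZ) (linD linO) (linD linZ) Z_E Z_psi /s fx.
by rewrite !scaleN1r opprD opprK.
Qed.

(* The amplitude of [k] portions, of weight [1 / (2K)] each: [eD] holds [K] of the
   [2K] portions, and [eA] and [eB] share the others. *)
Definition amp k : C := (Num.sqrt (k%:R / (2 * K)%:R))%:C%C.

Lemma conj_amp k : conjc (amp k) = amp k.
Proof. exact: conjc_real. Qed.

Lemma ampE k : amp k * amp k = (k%:R / (2 * K)%:R)%:C%C.
Proof. by rewrite -rmorphM -expr2 sqr_sqrtr // divr_ge0 ?ler0n. Qed.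

Lemma ampS k : amp k.+1 * amp k.+1 = amp k * amp k + amp 1 * amp 1.
Proof. by rewrite !ampE -rmorphD /= -mulrDl -[k.+1]addn1 natrD. Qed.

Lemma ampK : amp K * amp K = 2%:R^-1.
Proof.
rewrite ampE natrM invfM mulrCA divff ?mulr1 ?fmorphV ?rmorph_nat //.
by rewrite pnatr_eq0 -lt0n.
Qed.

(** The reflection along this vector trades [k + 1] portions on [E i] for [k] portions there and one
    on [eP], and back; it does not depend on the input. *)
Definition splitter i k := amp k.+1 *: E i - (amp k *: E i + amp 1 *: eP).

Lemma splitter_fix i k z : inner (E i) z = 0 -> inner eP z = 0 ->
  householder (splitter i k) z = z.
Proof.
by move=> iz pz; rewrite householder_fix // !innerE iz pz !mulr0 addr0 subr0.
Qed.

Lemma splitter_conditions i k : i != (true, true) ->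
  let u := amp k.+1 *: E i in let v := amp k *: E i + amp 1 *: eP in
  inner u u = inner v v /\ inner u v = inner v u.
Proof.
move=> iP u v; have iP0 : inner (E i) eP = 0 by rewrite E_orth (negbTE iP).
rewrite /u /v !innerE !conj_amp iP0 (inner_eq0C iP0) !E_orth !eqxx.
by split; [have := ampS k|]; rewrite !mulr1 !mulr0 !addr0 ?add0r // mulrC.
Qed.

Lemma splitter_split i k : i != (true, true) ->
  householder (splitter i k) (amp k.+1 *: E i) = amp k *: E i + amp 1 *: eP.
Proof. by case/(splitter_conditions k) => uu uv; apply: householder_swap. Qed.

Lemma splitter_merge i k : i != (true, true) ->
  householder (splitter i k) (amp k *: E i + amp 1 *: eP) = amp k.+1 *: E i.
Proof.
case/(splitter_conditions k) => uu uv.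
by rewrite -householderN opprB; apply: householder_swap.
Qed.

Lemma catalyst_decides : exists init pre post P, [/\ lin_isometry init,
    forall t, lin_isometry (pre t), forall t, lin_isometry (post t), orthoproj P &
    forall x, x \in X -> let y := evolve orc pre post x (init k0) K in
      2%:R / 3%:R <= if f x then sqn (P y) else sqn (y - P y)].
Proof.
have [Rf [Rf_iso Rf_E Rf_psi]] := query_reflection.
(* Before step [t], [eA] holds [K - t] portions and [eB] holds [t]; one portion moves from [eA]
   through [eP] to [eB]. *)
pose pre t := Rf \o householder (splitter (false, false) (K - t.+1)).
pose post t := householder (splitter (false, true) t) \o Z.
pose u0 := amp K *: eA + amp K *: eD; pose u1 := amp K *: eB + amp K *: eD.
have Ei i j : inner (E i) (E j) = (i == j)%:R := E_orth i j.
have psiE i x : inner (psi x) (E i) = 0 by apply: inner_eq0C.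
have half2 : 2%:R^-1 + 2%:R^-1 = 1 :> C by rewrite [RHS]splitr mul1r.
have u0_unit : inner u0 u0 = 1.
  by rewrite !innerE !conj_amp !Ei /= !mulr1 !mulr0 addr0 add0r ampK half2.
have u1_unit : sqn u1 = 1.
  apply: complexI; rewrite -inner_sqn.
  by rewrite !innerE !conj_amp !Ei /= !mulr1 !mulr0 addr0 add0r ampK half2.
have init_u0 : householder (k0 - u0) k0 = u0.
  by apply: householder_swap; rewrite ?k0_unit ?u0_unit // !innerE !k0_E !conj_amp.
have iso_pre t : lin_isometry (pre t).
  by apply: lin_isometry_comp => //; apply: householder_isometry.
have iso_post t : lin_isometry (post t).
  by apply: lin_isometry_comp => //; apply: householder_isometry.
(* The measurement tests for [u1], the ideal outcome for value 1 up to the catalyst; for value 0 the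
   sign on [eB] makes the ideal outcome orthogonal to [u1]. *)
have [P [orthoP fixP killP]] := orthoproj_exists [:: u1].
have [linP _ _] := orthoP.
exists (householder (k0 - u0)), pre, post, P.
split=> // [|x xX]; first exact: householder_isometry.
rewrite init_u0.
(* The ideal state includes the catalyst; the actual start [u0], being the same for all inputs,
   lacks the term [amp 1 *: psi x]. *)
pose yhat t := amp (K - t) *: eA + (s x * amp t) *: eB + amp K *: eD + amp 1 *: psi x.
pose y t := evolve orc pre post x u0 t.
have step_iso t : lin_isometry (post t \o (orc x \o pre t)).
  by do 2!apply: lin_isometry_comp => //; apply: orc_isometry.
have step t : (t < K)%N -> (post t \o (orc x \o pre t)) (yhat t) = yhat t.+1.
  move=> tK; have KtS : (K - t)%N = (K - t.+1).+1 by rewrite subnSK.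
  rewrite /= /pre /post /=.
  have [linH _] := householder_isometry (splitter (false, false) (K - t.+1)).
  have -> : householder (splitter (false, false) (K - t.+1)) (yhat t) =
      amp (K - t.+1) *: eA + (s x * amp t) *: eB + amp K *: eD + amp 1 *: (eP + psi x).
    rewrite /yhat KtS !(linD linH) splitter_split // !(linZ linH).
    rewrite !splitter_fix ?Ei ?E_psi // scalerDr !addrA.
    by rewrite [LHS](ACl (1*3*4*2*5)).
  have [linT _] : lin_isometry (Z \o (orc x \o Rf)).
    by do 2!apply: lin_isometry_comp => //; apply: orc_isometry.
  rewrite -[Z _]/((Z \o (orc x \o Rf)) _) !(linD linT) !(linZ linT).
  rewrite [(Z \o _) (eP + _)]Rf_psi // ![(Z \o _) _]Rf_E //.
  (* Processed portions in [eB] and the new one on [eP] share the sign [s x]; factoring it out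
     exposes the vector that the merging reflection handles. *)
  have -> : amp (K - t.+1) *: eA + (s x * amp t) *: eB + amp K *: eD +
      amp 1 *: (s x *: eP + psi x) = amp (K - t.+1) *: eA +
      s x *: (amp t *: eB + amp 1 *: eP) + amp K *: eD + amp 1 *: psi x.
    rewrite !scalerDr !scalerA [amp 1 * _]mulrC !addrA.
    by rewrite [LHS](ACl (1*2*4*3*5)).
  have [linM _] := householder_isometry (splitter (false, true) t).
  rewrite !(linD linM) ![householder _ (_ *: _)](linZ linM) splitter_merge //.
  by rewrite !splitter_fix ?Ei ?E_psi // scalerA.
have amp0 : amp 0 = 0 by rewrite /amp mul0r sqrtr0.
(* Actual and ideal states pass through the same isometries, so the initial discrepancy keeps its
   norm. *)
have err t : (t <= K)%N -> sqn (y t - yhat t) = sqn (amp 1 *: psi x).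
  elim: t => [_|t IHt tK].
    rewrite -[y 0]/u0 /yhat subn0 amp0 mulr0 scale0r addr0 opprD addrA subrr add0r.
    by rewrite /sqn innerNl innerNr opprK.
  have [linF _] := step_iso t.
  by rewrite -[y t.+1]/((post t \o (orc x \o pre t)) (y t)) -step // -(linN linF)
       -(linD linF) (lin_isometry_sqn _ (step_iso t)) IHt // ltnW.
(* The square of [amp 1] is [1 / (2K)], and [50 A <= K] gives [A / (2K) <= 1 / 100]. *)
have err_small : sqn (y K - yhat K) <= 100%:R^-1.
  rewrite err // sqnZ; have -> : sqnorm (amp 1) = 1 / (2 * K)%:R.
    by apply: complexI; rewrite -mulJ_sqnorm conj_amp ampE.
  have psiA := psi_le xX; have K0 : 0 < K%:R :> R by rewrite ltr0n.
  rewrite mulrAC ler_pdivrMr natrM; first by move: (sqn _) K%:R A psiA K_ge K0 => q k a; lra.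
  by rewrite mulr_gt0 ?ltr0n.
move: err_small; set d := y K - yhat K => err_small.
have yE : y K = yhat K + d by rewrite addrC subrK.
have Pd := sqn_orthoproj orthoP d.
have Pd_ge := sqn_ge0 (P d); have Pd'_ge := sqn_ge0 (d - P d).
change (2%:R / 3%:R <= if f x then sqn (P (y K)) else sqn (y K - P (y K))).
case fx: (f x).
  have -> : P (y K) = u1 + P d.
    rewrite yE (linD linP) /yhat subnn amp0 scale0r add0r /s fx mul1r.
    rewrite (linD linP) fixP ?mem_head // killP ?addr0 // => u; rewrite inE => /eqP ->.
    by rewrite !innerE !E_psi !mulr0 addr0 mulr0.
  (* The resulting bound is [9/10 - 9/100 = 81/100], above [2/3]; the other case uses the same
     numbers. *)
  have := sqnD_ge u1 (P d); rewrite u1_unit; lra.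
have yhatE : yhat K = - (amp K *: eB) + amp K *: eD + amp 1 *: psi x.
  by rewrite /yhat subnn amp0 scale0r add0r /s fx mulN1r scaleNr.
have -> : y K - P (y K) = yhat K + (d - P d).
  rewrite yE (linD linP) killP ?add0r ?addrA // => u; rewrite inE => /eqP ->.
  rewrite yhatE !innerE !conj_amp !Ei !E_psi /=; ring.
(* The catalyst is orthogonal to the bookkeeping states, so it can only add to the norm. *)
have : 1 <= sqn (yhat K).
  have -> : sqn (yhat K) = 1 + sqn (amp 1 *: psi x).
    apply: complexI; rewrite rmorphD /= -!inner_sqn yhatE !innerE !conj_amp.
    by rewrite !Ei !E_psi !psiE /= -[X in _ = X + _]half2 -!ampK; ring.
  by rewrite lerDl sqn_ge0.
have := sqnD_ge (yhat K) (d - P d); lra.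
Qed.

End Catalyst.

End HermitianSpace.

(** * The finite-dimensional state space and matrices of linear maps *)

Section StateSpace.
Set Implicit Arguments.
Unset Strict Implicit.
Variables (R : realType) (Q : finType).
Local Notation C := R[i].
Local Notation V := {ffun Q -> C^o}.
Implicit Types (u v : V).

Definition cdot u v : C := \sum_q conjc (u q) * v q.
Definition ket (p : Q) : V := [ffun q => (q == p)%:R].
Definition matr (F : V -> V) (q p : Q) : C := F (ket p) q.

Lemma cdot_sqnorm u : cdot u u = (\sum_q sqnorm (u q))%:C%C.
Proof. by rewrite rmorph_sum; apply: eq_bigr => q _; rewrite mulJ_sqnorm. Qed.

Lemma cdot_hermitian : hermitian_form cdot.
Proof.
split=> [u v w|a u v|u v|u|u].
- by rewrite /cdot -big_split; apply: eq_bigr => q _; rewrite ffunE mulrDr.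
- by rewrite /cdot mulr_sumr; apply: eq_bigr => q _; rewrite ffunE; apply: mulrCA.
- rewrite /cdot rmorph_sum; apply: eq_bigr => q _.
  by rewrite rmorphM /= conjcK mulrC.
- by rewrite cdot_sqnorm ler0c; apply: sumr_ge0 => q _; apply: sqnorm_ge0.
rewrite cdot_sqnorm => /complexI /psumr_eq0P u0.
apply/ffunP => q; rewrite ffunE; apply/eqP; rewrite eq_complex.
have /eqP := u0 (fun q _ => sqnorm_ge0 (u q)) q isT.
by rewrite paddr_eq0 ?sqr_ge0 // !sqrf_eq0.
Qed.

Lemma sqn_cdot u : sqn cdot u = \sum_q sqnorm (u q).
Proof. by rewrite /sqn cdot_sqnorm. Qed.

Lemma ket_cdot u q : cdot (ket q) u = u q.
Proof.
rewrite /cdot (bigD1 q) //= big1 ?addr0 ?ffunE ?eqxx ?conjc1 ?mul1r //.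
by move=> r /negbTE rq; rewrite ffunE rq conjc0 mul0r.
Qed.

Lemma lin_matr (F : V -> V) u q : linear F -> F u q = \sum_p matr F q p * u p.
Proof.
move=> linF; have {1}-> : u = \sum_p u p *: ket p.
  apply/ffunP => r; rewrite sum_ffunE (bigD1 r) //= big1 ?addr0.
    by rewrite !ffunE eqxx; apply/esym/mulr1.
  by move=> p pr; rewrite !ffunE eq_sym (negbTE pr); apply: mulr0.
rewrite (lin_sum linF) sum_ffunE; apply: eq_bigr => p _.
by rewrite (linZ linF) ffunE; apply: mulrC.
Qed.

End StateSpace.

(** * Translation of isometries into the query model *)

Section QueryAlgorithms.
Set Implicit Arguments.
Unset Strict Implicit.
Variables (R : realType) (n W : nat).
Local Notation C := R[i].
Local Notation Q := (qspace n W).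
Local Notation V := {ffun Q -> C^o}.
Implicit Types (u v : V) (x y : cube n).

Definition orc x u : V := [ffun q => oracle x u q].

Lemma orc_isometry x : lin_isometry (@cdot R Q) (orc x).
Proof.
split=> [a u v|u v].
  by apply/ffunP => -[[i b] w]; rewrite !ffunE /= !ffunE.
pose flip (q : Q) : Q := (q.1.1, q.1.2 (+) x q.1.1, q.2).
have flipK : involutive flip by case=> -[i b] w; rewrite /flip /= addbK.
rewrite /cdot [RHS](reindex_inj (inv_inj flipK)).
by apply: eq_bigr => -[[i b] w] _; rewrite !ffunE.
Qed.

Lemma qapply_matr (F : V -> V) (psi : Q -> C) u :
  linear F -> psi =1 u -> qapply (matr F) psi =1 F u.
Proof.
move=> linF psiE q; rewrite (lin_matr _ _ linF).
by apply: eq_bigr => p _; rewrite psiE.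
Qed.

Lemma matr_unitary (F : V -> V) : lin_isometry (@cdot R Q) F -> unitary (matr F).
Proof.
case=> _ isoF a b; transitivity (cdot (ket R a) (ket R b)); last first.
  by rewrite ket_cdot ffunE.
by rewrite -isoF.
Qed.

Lemma matr_projector (P : V -> V) : orthoproj (@cdot R Q) P -> projector (matr P).
Proof.
case=> linP adjP idP; split=> a b.
  rewrite /matr -!ket_cdot -adjP; apply/esym.
  by case: (@cdot_hermitian R Q).
by rewrite -(lin_matr _ _ linP) idP.
Qed.

(** Adjacent maps [post t] and [pre t.+1] fuse into one unitary, so the state of the query model is
    one pending [pre t] ahead of [evolve]. *)
Lemma evolve_qstate (T : nat) (pre post : nat -> V -> V) (init : V -> V) (q0 : Q) :
    lin_isometry (@cdot R Q) init ->
    (forall t, lin_isometry (@cdot R Q) (pre t)) ->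
    (forall t, lin_isometry (@cdot R Q) (post t)) ->
  exists U, (forall t, unitary (U t)) /\
    forall x, qstate x U q0 T =1 evolve orc pre post x (init (ket R q0)) T.
Proof.
move=> iso_init iso_pre iso_post.
(* No query follows time [T], so nothing is pending there and the two states coincide. *)
pose G t := if (t < T)%N then pre t else id.
have isoG t : lin_isometry (@cdot R Q) (G t) by rewrite /G; case: ifP.
pose F t := G t \o (if t is t'.+1 then post t' else init).
have isoF t : lin_isometry (@cdot R Q) (F t).
  by apply: lin_isometry_comp => //; case: t.
exists (fun t => matr (F t)); split=> [t|x]; first exact: matr_unitary.
pose y := evolve orc pre post x (init (ket R q0)).
suff inv t : (t <= T)%N -> qstate x (fun t => matr (F t)) q0 t =1 G t (y t).
  by move=> q; rewrite inv // /G ltnn.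
elim: t => [_|t IHt t_lt].
  rewrite /=; apply: qapply_matr; first by case: (isoF 0%N).
  by move=> q; rewrite ffunE.
have -> : G t.+1 (y t.+1) = F t.+1 (orc x (G t (y t))).
  by rewrite /F /= [G t](_ : _ = pre t) // /G t_lt.
apply: qapply_matr; first by case: (isoF t.+1).
by move=> -[[i b] w]; rewrite ffunE; apply: IHt; apply: ltnW.
Qed.

Lemma evolve_decides (X : {set cube n}) f T (pre post : nat -> V -> V)
    (init P : V -> V) (q0 : Q) :
    lin_isometry (@cdot R Q) init ->
    (forall t, lin_isometry (@cdot R Q) (pre t)) ->
    (forall t, lin_isometry (@cdot R Q) (post t)) ->
    orthoproj (@cdot R Q) P ->
    (forall x, x \in X -> let y := evolve orc pre post x (init (ket R q0)) T in
      2%:R / 3%:R <= if f x then sqn (@cdot R Q) (P y) else sqn (@cdot R Q) (y - P y)) ->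
  exists (U : nat -> Q -> Q -> C) (P' : Q -> Q -> C), decides_f X f T U q0 P'.
Proof.
move=> iso_init iso_pre iso_post orthoP prob.
have [U [unitU stateU]] := evolve_qstate T q0 iso_init iso_pre iso_post.
have [linP _ _] := orthoP.
exists U, (matr P); split; [by []|split; first exact: matr_projector].
move=> x /prob; cbv zeta.
case: (f x); rewrite sqn_cdot => /le_trans; apply; rewrite le_eqVlt; apply/orP; left; apply/eqP.
  by apply: eq_bigr => q _; rewrite (qapply_matr linP (stateU x)).
apply: eq_bigr => q _; rewrite (qapply_matr linP (stateU x)) stateU.
by rewrite !ffunE.
Qed.

End QueryAlgorithms.

(** * Catalysts built from a deciding vector set *)

(* The memory register either names one of four bookkeeping states or
   stores a bit and a coordinate of the vectors.  Bookkeeping states hold the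
   oracle bit in [|+>], so queries fix them; catalysts hold it in [|->], so a
   query on [|j>] multiplies them by [(-1)^(x_j)]. *)
Section DecidingVectors.
Set Implicit Arguments.
Unset Strict Implicit.
Variables (R : realType) (n k : nat) (X : {set cube n}) (f : cube n -> bool).
Variables (w : cube n -> 'I_n -> 'I_k -> R[i]) (i0 : 'I_n).
Hypothesis w_deciding : deciding X f w.
Local Notation C := R[i].

Definition memory := (bool * bool + bool * 'I_k)%type.
Local Notation W := #|{: memory}|.
Local Notation Q := (qspace n W).
Local Notation V := {ffun Q -> C^o}.

Implicit Types (x y : cube n) (u v : V) (h : bool * bool).

Definition tabulate (G : 'I_n -> bool -> memory -> C) : V :=
  [ffun q => G q.1.1 q.1.2 (enum_val q.2)].

Lemma cdot_tabulate G H : cdot (tabulate G) (tabulate H) =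
  \sum_i \sum_b (\sum_h conjc (G i b (inl h)) * H i b (inl h) +
                 \sum_c \sum_l conjc (G i b (inr (c, l))) * H i b (inr (c, l))).
Proof.
pose T i b t := conjc (G i b t) * H i b t.
transitivity (\sum_i \sum_b \sum_(t : 'I_W) T i b (enum_val t)).
  rewrite pair_bigA pair_bigA; apply: eq_bigr => -[[i b] t] _.
  by rewrite !ffunE.
apply: eq_bigr => i _; apply: eq_bigr => b _.
transitivity (\sum_t T i b t).
  by rewrite [RHS](reindex _ (onW_bij _ (enum_val_bij memory))).
rewrite big_sumType; congr (_ + _).
by rewrite pair_bigA; apply: eq_bigr => -[].
Qed.

Definition rhalf : C := (Num.sqrt 2%:R^-1)%:C%C.

Lemma conj_rhalf : conjc rhalf = rhalf.
Proof. exact: conjc_real. Qed.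

Lemma rhalfE : rhalf * rhalf + rhalf * rhalf = 1.
Proof.
rewrite -rmorphM -expr2 sqr_sqrtr ?invr_ge0 ?ler0n // -rmorphD /=.
by rewrite -[RHS](rmorph1 (real_complex R)) [X in _ = _ X]splitr mul1r.
Qed.

Definition plus_state h : V :=
  tabulate (fun i _ t => if (i == i0) && (t == inl h) then rhalf else 0).

(** The flag [x i (+) ~~ f x] makes the catalysts of inputs with different values overlap exactly
    where the inputs differ; the sign depending on [f x] turns that overlap from 1 into -1. *)
Definition catalyst (x : cube n) : V := tabulate (fun i b t =>
  if t is inr (c, l) then
    if c == x i (+) ~~ f x then (-1) ^+ (~~ f x (+) b) * rhalf * w x i l else 0
  else 0).

Lemma cdot_plus_state h h' : cdot (plus_state h) (plus_state h') = (h == h')%:R.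
Proof.
rewrite cdot_tabulate (bigD1 i0) //= [X in _ + X]big1 => [|i /negbTE ->]; last first.
  by rewrite big1 // => b _; rewrite !big1 ?addr0 // => *;
     rewrite ?big1 // => *; rewrite mulr0.
have sum_h : \sum_h0 conjc (if (i0 == i0) && (inl h0 == inl h :> memory) then rhalf else 0)
     * (if (i0 == i0) && (inl h0 == inl h' :> memory) then rhalf else 0) =
   (h == h')%:R * (rhalf * rhalf).
  rewrite (bigD1 h) //= big1 => [|h1 /negbTE h1h].
    by rewrite !eqxx addr0 conj_rhalf -[inl h == _]/(h == h'); case: eqP; rewrite ?mul1r ?mulr0 ?mul0r.
  by rewrite eqxx -[inl h1 == _]/(h1 == h) h1h conjc0 mul0r.
rewrite addr0; transitivity (\sum_(b : bool) (h == h')%:R * (rhalf * rhalf)).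
  apply: eq_bigr => b _; rewrite sum_h [X in _ + X]big1 ?addr0 // => c _.
  by rewrite big1 // => l _; rewrite andbF mulr0.
by rewrite big_bool -[LHS]mulrDr rhalfE mulr1.
Qed.

Lemma cdot_plus_catalyst h x : cdot (plus_state h) (catalyst x) = 0.
Proof.
rewrite cdot_tabulate big1 // => i _; rewrite big1 // => b _.
rewrite !big1 ?addr0 // => [c _|h' _]; last by rewrite mulr0.
by rewrite big1 // => l _; rewrite andbF conjc0 mul0r.
Qed.

Lemma cdot_catalyst x y : cdot (catalyst x) (catalyst y) =
  (-1) ^+ (f x (+) f y) *
    \sum_(i | x i (+) ~~ f x == y i (+) ~~ f y) dotc (w x i) (w y i).
Proof.
rewrite cdot_tabulate mulr_sumr [RHS]big_mkcond; apply: eq_bigr => i _.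
set cx := x i (+) _; set cy := y i (+) _.
pose D := (-1) ^+ (f x (+) f y) * dotc (w x i) (w y i).
transitivity (\sum_(b : bool) (if cx == cy then rhalf * rhalf * D else 0)).
  apply: eq_bigr => b _; rewrite big1 ?add0r => [|h _]; last by rewrite mulr0.
  rewrite (bigD1 cx) //= [X in _ + X]big1 ?addr0 => [|c /negbTE cxF]; last first.
    by rewrite big1 // => l _; rewrite cxF conjc0 mul0r.
  rewrite eqxx; case: eqP => _; last by rewrite big1 // => l _; rewrite mulr0.
  rewrite /D /dotc !mulr_sumr; apply: eq_bigr => l _.
  rewrite !conjcM conj_rhalf.
  have -> : conjc ((-1) ^+ (~~ f x (+) b)) = (-1) ^+ (~~ f x (+) b) :> C.
    by rewrite rmorph_sign.
  (* Both catalysts carry [b] in their sign, so it cancels in the product. *)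
  have -> : (-1) ^+ (f x (+) f y) = (-1) ^+ (~~ f x (+) b) * (-1) ^+ (~~ f y (+) b) :> C.
    by rewrite -signr_addb; congr (_ ^+ _); case: (f x) (f y) b => -[] [].
  ring.
rewrite big_bool; case: ifP => _; last exact: addr0.
by rewrite -[LHS]mulrDl rhalfE mul1r.
Qed.

Lemma catalyst_decides_pair x y : x \in X -> y \in X -> f x != f y ->
  cdot (catalyst x) (catalyst y) = -1.
Proof.
move=> xX yX fxy; rewrite cdot_catalyst addbC -negb_eqb eq_sym fxy.
rewrite (eq_bigl (fun i => x i != y i)) ?w_deciding ?mulr1 // => i.
by move: fxy; case: (f x) (f y) (x i) (y i) => -[] [] [].
Qed.

Lemma sqn_catalyst x : x \in X -> sqn (@cdot R Q) (catalyst x) <= vsize X w.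
Proof.
move=> xX; have -> : sqn (@cdot R Q) (catalyst x) = \sum_j vnorm2 (w x j).
  apply: complexI; rewrite -inner_sqn; last exact: cdot_hermitian.
  rewrite cdot_catalyst addbb mul1r (eq_bigl predT) => [|i]; last exact: eqxx.
  rewrite rmorph_sum; apply: eq_bigr => i _; rewrite rmorph_sum.
  by apply: eq_bigr => l _; apply: mulJ_sqnorm.
exact: (le_bigmax_cond _ (fun x => \sum_j vnorm2 (w x j))).
Qed.

(** Two catalysts with product -1 have squared norms summing to at least 2. The bound absorbs the
    rounding of the number of queries. *)
Lemma vsize_ge1 x y : x \in X -> y \in X -> f x != f y -> 1 <= vsize X w.
Proof.
move=> xX yX fxy.
have := sqn_anticorrelated (@cdot_hermitian R Q) (catalyst_decides_pair xX yX fxy).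
rewrite -(ler_pM2l (ltr0n _ 2)) mulr1 => /le_trans; apply.
by rewrite mulr_natl mulr2n; apply: lerD; apply: sqn_catalyst.
Qed.

Definition flag_sign (t : memory) : C := if t is inr (c, _) then (-1) ^+ c else 1.

Definition flag_phase (u : V) : V := [ffun q => flag_sign (enum_val q.2) * u q].

Lemma flag_phase_isometry : lin_isometry (@cdot R Q) flag_phase.
Proof.
split=> [a u v|u v].
  by apply/ffunP => q; rewrite !ffunE mulrDr; congr (_ + _); apply: mulrCA.
apply: eq_bigr => q _; rewrite !ffunE conjcM mulrACA.
rewrite (_ : conjc _ * _ = 1) ?mul1r // /flag_sign.
case: (enum_val _) => [_|[c _]]; first by rewrite conjc1 mulr1.
by rewrite rmorph_sign -signr_addb addbb.
Qed.

Lemma phase_plus_state x h : flag_phase (orc x (plus_state h)) = plus_state h.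
Proof.
apply/ffunP => -[[i b] t]; rewrite !ffunE /= ffunE /=.
case: (enum_val t) => [h'|c]; first by rewrite mul1r.
by rewrite andbF mulr0.
Qed.

(** The query contributes [(-1) ^+ x i] and the flag [(-1) ^+ (x i (+) ~~ f x)]; the input bits
    cancel, leaving a sign independent of [i]. *)
Lemma phase_catalyst x :
  flag_phase (orc x (catalyst x)) = ((-1) ^+ (~~ f x) : C) *: catalyst x.
Proof.
apply/ffunP => -[[i b] t]; rewrite !ffunE /= ffunE /=.
case: (enum_val t) => [h'|[c l]]; first by rewrite mulr0 [RHS]mulr0.
case: eqP => [->|_]; last by rewrite mulr0 [RHS]mulr0.
rewrite -[RHS]/(_ * _) !mulrA; congr (_ * _ * _); rewrite -!signr_addb.
by congr (_ ^+ _); case: (f x) (x i) b => -[] [].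
Qed.

Lemma deciding_algorithm (K : nat) : (0 < K)%N -> 50%:R * vsize X w <= K%:R ->
  exists (U : nat -> Q -> Q -> C) (q0 : Q) (P : Q -> Q -> C), decides_f X f K U q0 P.
Proof.
move=> K_gt0 K_ge.
(* The products of this basis state with the plus states are real, as the reflection preparing the
   initial state requires. *)
pose q0 : Q := (i0, false, enum_rank (inl (false, false) : memory)).
have k0_E h : cdot (ket R q0) (plus_state h) = cdot (plus_state h) (ket R q0).
  case: (@cdot_hermitian R Q) => _ _ conj_cdot _ _; rewrite -[RHS]conj_cdot.
  by rewrite ket_cdot ffunE /=; case: ifP; rewrite ?conj_rhalf ?conjc0.
have k0_unit : cdot (ket R q0) (ket R q0) = 1 by rewrite ket_cdot ffunE eqxx.
have [init [pre [post [P [? ? ? ? ?]]]]] :=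
  catalyst_decides (@cdot_hermitian R Q) k0_unit k0_E (@orc_isometry R n W)
    cdot_plus_state cdot_plus_catalyst sqn_catalyst catalyst_decides_pair
    flag_phase_isometry phase_plus_state phase_catalyst K_gt0 K_ge.
have [||||//|U [P' UP]] := @evolve_decides R n W X f K pre post init P q0 => //.
by exists U, q0, P'.
Qed.

End DecidingVectors.

(** * Compression of the vectors to the spans of the 1-inputs *)

Section DimensionReduction.
Set Implicit Arguments.
Unset Strict Implicit.
Variable R : realType.
Local Notation C := R[i].
Local Notation "M ^t*" := (map_mx conjc M^T) (at level 30).

Lemma trmxC_mul p m k (M : 'M[C]_(p, m)) (N : 'M[C]_(m, k)) :
  (M *m N)^t* = N^t* *m M^t*.
Proof. by rewrite trmx_mul map_mxM. Qed.

Lemma trmxC_involutive p m (M : 'M[C]_(p, m)) : M^t*^t* = M.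
Proof. exact: trmxCK. Qed.

(** Take [E = B^* D], with the rows of [B] an orthonormal basis of the row space of [M] and [D]
    padding to [k] columns. Then [E E^*] is the orthogonal projector onto that row space; the
    padding gives all [j] a common dimension. *)
Lemma partial_isometry_of_rank p m k (M : 'M[C]_(p, m)) : (\rank M <= k)%N ->
  exists E : 'M[C]_(m, k), M *m E *m E^t* = M /\ E *m E^t* *m E = E.
Proof.
move=> rMk; pose B := schmidt (row_base M).
have BB : B *m B^t* = 1%:M by apply/unitarymxP/schmidt_unitarymx/rank_leq_col.
pose D : 'M[C]_(\rank M, k) := pid_mx (\rank M).
have DD : D *m D^t* = 1%:M.
  rewrite tr_pid_mx map_pid_mx mul_pid_mx minnn (minn_idPr rMk).
  exact: pid_mx_1.
have /submxP[Y MY] : (M <= B)%MS.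
  by rewrite (eqmx_schmidt_free (row_base_free M)) eq_row_base.
have MBB (U : 'M[C]_(p, m)) : U = Y *m B -> U *m B^t* *m B = U.
  by move=> ->; rewrite -(mulmxA Y) BB mulmx1.
exists (B^t* *m D); rewrite trmxC_mul trmxC_involutive; split.
  by rewrite !mulmxA -(mulmxA (M *m _)) DD mulmx1 MBB.
rewrite !mulmxA -(mulmxA _ D) DD mulmx1 -(mulmxA _ B) BB mulmx1 //.
Qed.

Definition rowf m (u : 'I_m -> C) : 'rV[C]_m := \row_l u l.

Lemma dotcE m (u v : 'I_m -> C) : dotc u v = (rowf v *m (rowf u)^t*) 0 0.
Proof. by rewrite mxE; apply: eq_bigr => l _; rewrite !mxE mulrC. Qed.

Lemma rowfK m (U : 'rV[C]_m) : rowf (U 0) = U.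
Proof. by apply/rowP => l; rewrite mxE. Qed.

Lemma dotc_vnorm2 m (u : 'I_m -> C) : dotc u u = (vnorm2 u)%:C%C.
Proof. by rewrite rmorph_sum; apply: eq_bigr => l _; apply: mulJ_sqnorm. Qed.

Lemma vnorm2_ge0 m (u : 'I_m -> C) : 0 <= vnorm2 u.
Proof. by apply: sumr_ge0 => l _; apply: sqnorm_ge0. Qed.

Section Coordinates.
Variables (m k : nat) (E : 'M[C]_(m, k)).
Definition coordinates (u : 'I_m -> C) : 'I_k -> C := (rowf u *m E) 0.

(** The product of coordinates has [E E^*] between the two vectors, so it suffices that one of them
    is fixed by it. *)
Lemma dotc_coordinates_r u v : rowf v *m E *m E^t* = rowf v ->
  dotc (coordinates u) (coordinates v) = dotc u v.
Proof. by move=> vE; rewrite !dotcE !rowfK trmxC_mul mulmxA vE. Qed.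

Lemma dotc_coordinates_l u v : rowf u *m E *m E^t* = rowf u ->
  dotc (coordinates u) (coordinates v) = dotc u v.
Proof.
move=> uE; rewrite !dotcE !rowfK -[in RHS]uE !trmxC_mul trmxC_involutive.
by rewrite !mulmxA.
Qed.

(** Pythagoras: the residual [z] is killed by [E], hence orthogonal to the projection, whose norm is
    that of the coordinates. *)
Lemma vnorm2_coordinates u : E *m E^t* *m E = E -> vnorm2 (coordinates u) <= vnorm2 u.
Proof.
move=> EEE; pose z := rowf u - rowf u *m E *m E^t*.
suff -> : vnorm2 u = vnorm2 (coordinates u) + vnorm2 (z 0) by rewrite lerDl vnorm2_ge0.
apply: complexI; rewrite rmorphD /= -!dotc_vnorm2 !dotcE !rowfK.
have zE : z *m E = 0 by rewrite mulmxBl -[in X in X - _]EEE !mulmxA subrr.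
have zz : z *m z^t* = z *m (rowf u)^t*.
  rewrite {2}/z linearB /= map_mxB mulmxBr trmxC_mul trmxC_involutive mulmxA.
  by rewrite zE mul0mx subr0.
have -> : rowf u *m (rowf u)^t* = rowf u *m E *m (rowf u *m E)^t* + z *m z^t*.
  by rewrite zz mulmxBl trmxC_mul mulmxA addrC subrK.
exact: mxE.
Qed.

End Coordinates.

Lemma dimension_reduction n (X : {set cube n}) f m (v : cube n -> 'I_n -> 'I_m -> C) :
  deciding X f v ->
  exists w : cube n -> 'I_n -> 'I_(maxrank X f v) -> C,
    deciding X f w /\ vsize X w <= vsize X v.
Proof.
move=> v_dec; pose M j := \matrix_(i < #|{: cube n}|, l < m)
  (let x := enum_val i in if (x \in X) && f x then v x j l else 0).
(* Each position [j] has its own span, hence its own [E j]; products only pair vectors with the same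
   [j]. *)
have /fin_all_exists[E E_iso] j : exists E : 'M[C]_(m, maxrank X f v),
    M j *m E *m E^t* = M j /\ E *m E^t* *m E = E.
  by apply: partial_isometry_of_rank; apply: (leq_bigmax (F := rank_at X f v)).
have fixv x j : x \in X -> f x -> rowf (v x j) *m E j *m (E j)^t* = rowf (v x j).
  move=> xX fx; have -> : rowf (v x j) = row (enum_rank x) (M j).
    by apply/rowP => l; rewrite !mxE enum_rankK /= xX fx.
  by rewrite -!row_mul; case: (E_iso j) => ->.
exists (fun x j => coordinates (E j) (v x j)); split.
  move=> x y xX yX fxy; rewrite -(v_dec x y xX yX fxy); apply: eq_bigr => j _.
  case fx: (f x); first by apply/dotc_coordinates_l/fixv.
  by apply/dotc_coordinates_r/fixv => //; move: fxy; rewrite fx; case: (f y).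
apply: bigmax_le => [|x xX]; first exact: bigmax_ge_id.
apply: le_trans (le_bigmax_cond _ (fun x => \sum_j vnorm2 (v x j)) xX).
by apply: ler_sum => j _; apply: vnorm2_coordinates; case: (E_iso j).
Qed.

End DimensionReduction.

(** * Constant functions, numerical bounds and assembly *)

Lemma constant_algorithm (R : realType) (n : nat) (X : {set cube n})
    (f : cube n -> bool) (b : bool) (q0 : qspace n 1) :
    (forall x, x \in X -> f x = b) ->
  exists (U : nat -> qspace n 1 -> qspace n 1 -> R[i]) (P : qspace n 1 -> qspace n 1 -> R[i]),
    decides_f X f 0 U q0 P.
Proof.
move=> fb.
have ket1 : sqn (@cdot R (qspace n 1)) (ket R q0) = 1.
  by rewrite /sqn ket_cdot ffunE eqxx.
have lt23 : 2%:R / 3%:R <= 1 :> R by lra.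
pose P (u : {ffun qspace n 1 -> R[i]^o}) := if b then u else 0.
apply: (@evolve_decides R n 1 X f 0 (fun=> id) (fun=> id) id P) => //.
  rewrite /P; case: b {fb P}; split=> // [a u v|u v].
    by rewrite scaler0 addr0.
  have hermQ := @cdot_hermitian R (qspace n 1).
  by rewrite (inner0l hermQ) (inner0r hermQ).
by move=> x /fb ->; rewrite /P; case: b {fb P} => /=; rewrite ?subr0 ket1.
Qed.

(** As [t.+1] is at least 2, its fourth power is at least [16], which covers the factor [12]. *)
Lemma leq12_exp51 (s t : nat) : (0 < t)%N -> (s <= 12 * t)%N -> (s <= t.+1 ^ 51)%N.
Proof.
move=> t_gt0 /leq_trans; apply; rewrite expnSr leq_mul ?leqnSn //.
have /leq_trans : (12 <= t.+1 ^ 4)%N.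
  by apply: (leq_trans (isT : 12 <= 2 ^ 4)%N); rewrite leq_exp2r.
by apply; rewrite leq_pexp2l.
Qed.

Theorem theorem9 :
  exists c : nat,
  forall (R : realType) (n : nat), (0 < n)%N ->
  forall (X : {set cube n}) (f : cube n -> bool) (m : nat)
         (v : cube n -> 'I_n -> 'I_m -> R[i]),
  deciding X f v ->
  (exists w : cube n -> 'I_n -> 'I_(maxrank X f v) -> R[i],
      deciding X f w /\ vsize X w <= vsize X v) /\
  (exists (W T : nat) (U : nat -> qspace n W -> qspace n W -> R[i])
          (q0 : qspace n W) (P : qspace n W -> qspace n W -> R[i]),
      decides_f X f T U q0 P /\
      T%:R <= c%:R * vsize X v /\
      (n * 2 * W <= (n * maxn (maxrank X f v) 1).+1 ^ c)%N).
Proof.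
(* The query bound is [50 A] plus at most 1 for rounding, and [1 <= A] when [f] is not constant on
   [X]; the same constant serves as exponent in the space bound. *)
exists 51 => R n n_gt0 X f m v v_dec.
have [w [w_dec w_size]] := dimension_reduction v_dec.
split; first by exists w.
set k := maxrank X f v in w w_dec w_size *.
have t_gt0 : (0 < n * maxn k 1)%N by rewrite muln_gt0 n_gt0 leq_maxr.
have n_le : (n <= n * maxn k 1)%N by rewrite leq_pmulr ?leq_maxr.
have nk_le : (n * k <= n * maxn k 1)%N by rewrite leq_mul ?leq_maxl.
have [/exists_inP[x xX /exists_inP[y yX fxy]]|f_const] :=
  boolP [exists x in X, exists y in X, f x != f y].
  have A_ge1 : 1 <= vsize X v.
    exact: le_trans (vsize_ge1 w_dec xX yX fxy) w_size.
  pose K := (Num.truncn (50%:R * vsize X v)).+1.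
  have /andP[K_lo K_hi] : K.-1%:R <= 50%:R * vsize X v < K%:R.
    by apply: truncn_itv; rewrite mulr_ge0 ?ler0n // (le_trans ler01).
  have [||U [q0 [P UP]]] := deciding_algorithm (Ordinal n_gt0) w_dec (K := K) => //.
    by apply: (le_trans _ (ltW K_hi)); rewrite ler_pM2l ?ltr0n.
  exists #|{: memory k}|, K, U, q0, P; split=> //; split.
    have -> : 51%:R * vsize X v = 50%:R * vsize X v + vsize X v by ring.
    by rewrite -[K%:R]natr1 lerD.
  (* The memory has [4 + 2k] states, so the dimension is [8n + 4nk], at most [12 n] times
     [maxn k 1]. *)
  apply: leq12_exp51 => //; rewrite card_sum !card_prod !card_bool card_ord.
  lia.
(* For constant [f] the size may be 0, so no query can be afforded; the measurement is trivial. *)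
exists 1%N, 0%N.
have f_eq x : x \in X -> f x = [exists y in X, f y].
  move=> xX; apply/idP/exists_inP => [fx|[y yX fy]]; first by exists x.
  apply: contraNT f_const => fx; apply/exists_inP; exists x => //.
  by apply/exists_inP; exists y => //; rewrite fy (negbTE fx).
have [U [P UP]] := constant_algorithm R (Ordinal n_gt0, false, ord0) f_eq.
exists U, (Ordinal n_gt0, false, ord0), P; split=> //; split.
  by rewrite mulr_ge0 ?ler0n ?bigmax_ge_id.
by apply: leq12_exp51 => //; lia.
Qed.
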